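(* Let $G$ be a finite group. The property that $\chi(xy)=\chi(x)\chi(y)$ for all nonidentity elements $x,y\in G$ of prime power order with $(o(x),o(y))=1$ and every $\chi\in\mathrm{Irr}(G)$ holds if and only if either $G$ is a group of prime power order, or $G$ is an abelian group, or $G$ has the following structure: (i) $G=AP$, where $A>1$ is a cyclic $p'$-group and $P$ is a normal Sylow $p$-subgroup of $G$, for some prime $p$. (ii) If $C=C_P(A)$ and $D=[A,P]$, then $P=CD$ with $C$ abelian, $D\triangleleft G$ and $C\cap D=1$. (iii) The action of $A$ on $D$ is Frobenius.
   Context: $\mathrm{Irr}(G)$ denotes the set of irreducible complex characters of the finite group $G$; $o(g)$ is the order of $g$ and $(m,n)$ is the greatest common divisor. A $p'$-group is a finite group of order not divisible by $p$. $C_P(A)$ is the centralizer of $A$ in $P$ and $[A,P]$ is the subgroup generated by all commutators $[a,u]$ with $a\in A$, $u\in P$. The action (by conjugation) of $A$ on $D$ is Frobenius if no nonidentity element of $A$ fixes a nonidentity element of $D$, i.e. $C_D(a)=1$ for every $1\neq a\in A$. *)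

(* Defs.v *)
From mathcomp Require Import all_boot all_order all_fingroup all_algebra.
From mathcomp Require Import all_solvable all_field all_character.

Set Implicit Arguments.
Unset Strict Implicit.
Unset Printing Implicit Defensive.

Local Open Scope group_scope.

Definition prime_power (n : nat) : Prop :=
  exists p k : nat, prime p /\ n = (p ^ k)%N.

Definition irr_coprime_mult (gT : finGroupType) (G : {group gT}) : Prop :=
  forall x y : gT, x \in G -> y \in G -> x != 1 -> y != 1 ->
    prime_power #[x] -> prime_power #[y] -> gcdn #[x] #[y] = 1%N ->
    forall i : Iirr G, ('chi[G]_i (x * y)%g = 'chi_i x * 'chi_i y)%R.

(* [semiregular D A] only says that 'C_D[a] = 1 for every 1 != a \in A. Unlike
   [Frobenius G = K ><| H], it does not require D to be nontrivial. *)
Definition cyclic_by_Sylow_structure (gT : finGroupType) (G : {group gT}) :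
    Prop :=
  exists (p : nat) (A P : {group gT}),
    let C := 'C_P(A) in
    let D := [~: A, P] in
    [/\ [/\ prime p, A :!=: 1, cyclic A & p^'.-group A],
        [/\ P <| G, p.-Sylow(G) P & A * P = G],
        [/\ C * D = P, abelian C, D <| G & C :&: D = 1]
      & semiregular D A].

(* Main.v *)
Require Import Defs.
From mathcomp Require Import all_boot all_order all_fingroup all_algebra.
From mathcomp Require Import all_solvable all_field all_character.

Set Implicit Arguments.
Unset Strict Implicit.
Unset Printing Implicit Defensive.

Import Order.TTheory GRing.Theory Num.Theory GroupScope.

(** Write G' for the derived subgroup. Both directions rest on the second
orthogonality relation: the |G : G'| linear characters already contribute |G :
G'| to the sum of |chi(g)|^2 over Irr(G), which is |C_G(g)|. Hence all nonlinear
characters vanish at g exactly when |C_G(g)| = |G : G'|, that is, exactly when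
the class of g, which always lies in the coset gG', fills it
([sum_nonlinear_norm], [lcoset_der1_class]).

The property is vacuous in a p-group and clear when all irreducible characters
are linear. Suppose that G = AP has the stated structure. Then G' <= D. An
element g outside P has a nontrivial p'-part, conjugate to some a in A, and
Frobenius action gives |C_G(g)| <= |C_G(a)| <= |G : D| <= |G : G'|; so nonlinear
characters vanish off P. If x and y have coprime orders and are not both in P,
then xy is not in P either, because G / P would otherwise contain two mutually
inverse nontrivial elements of coprime orders. Both sides of chi(xy) =
chi(x)chi(y) are therefore 0 when chi is nonlinear.

Conversely, suppose that the multiplicative property holds in a nonabelian G.
Since x may be replaced by its conjugates, averaging chi(x^g y) over g gives
chi(x)chi(y) by hypothesis and chi(x)chi(y) / chi(1) by Schur's lemma
([sum_irr_conj_mul]). So chi(xy) = 0 for nonlinear chi, and the coset xyG' is a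
single class. If x is in G', this coset is yG', so that yG' is the class of y.
As 1 is not conjugate to y, no nontrivial y of prime power order coprime to that
of x lies in G'. Hence G' is a p-group for some prime p, a Sylow p-subgroup P is
normal, and it has an abelian complement A, trivial only if G is a p-group. For
y <> 1 of prime power order in A, the equality y^G = yG' forces G' = [A, P]
([der1_sub_commg]) and, by counting, C_{G'}(y) = 1 ([der1_cent1_trivial]). So A
acts semiregularly on D = G'. An abelian group acting semiregularly on a
nontrivial p-group is cyclic, and the other assertions about C and D follow from
coprime action. *)

(** * Nonlinear characters, centralizers and cosets of the derived subgroup *)

(** The sum of the matrices of the x ^ g commutes with the whole irreducible
representation, so by Schur's lemma it is a scalar, whose value is read off its
trace; multiplying by the matrix of y and taking traces gives the formula. *)
Lemma sum_irr_conj_mul (gT : finGroupType) (G : {group gT}) (i : Iirr G) x y :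
    x \in G -> y \in G ->
  ((\sum_(g in G) 'chi_i (x ^ g * y)%g) * 'chi_i 1%g
     = #|G|%:R * ('chi_i x * 'chi_i y))%R.
Proof.
move=> Gx Gy; pose rG := 'Chi_i.
have trE g : g \in G -> ('chi_i g = \tr (rG g))%R.
  by move=> Gg; rewrite -irrRepr cfunE Gg.
pose A := (\sum_(g in G) rG (x ^ g)%g)%R.
have cA : centgmx rG A.
  apply/centgmxP => h Gh; rewrite /A mulmx_suml mulmx_sumr.
  rewrite [RHS](reindex_inj (mulIg h)) /=; apply: eq_big => [g|g Gg].
    by rewrite groupMr.
  rewrite -!repr_mxM ?groupJ ?groupM //; congr (rG _).
  by rewrite conjgM conjgE mulKVg.
have [a defA] : exists a, A = (a%:M)%R.
  apply/is_scalar_mxP; apply: (mx_abs_irr_cent_scalar _ cA).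
  by apply: groupC; apply: socle_irr.
have trA : (a * 'chi_i 1%g = #|G|%:R * 'chi_i x)%R.
  rewrite trE // repr_mx1 -mxtraceZ scalemx1 -defA raddf_sum /=.
  rewrite mulr_natl -sumr_const; apply: eq_bigr => g Gg.
  by rewrite -trE ?groupJ // cfunJ.
rewrite mulrA -trA mulrAC; congr (_ * _)%R.
rewrite (trE y) // -mxtraceZ -mul_scalar_mx -defA mulmx_suml raddf_sum /=.
by apply: eq_bigr => g Gg; rewrite -repr_mxM ?groupJ // -trE // groupM ?groupJ.
Qed.

(** This is the second orthogonality relation at x, in which each linear
character contributes 1. *)
Lemma sum_nonlinear_norm (gT : finGroupType) (G : {group gT}) x : x \in G ->
  (#|'C_G[x]|%:R = #|G : G^`(1)|%:R
     + \sum_(i | 'chi[G]_i \isn't a linear_char) `|'chi_i x| ^+ 2 :> algC)%R.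
Proof.
move=> Gx; have := second_orthogonality_relation x Gx.
rewrite class_refl mulr1n => <-; rewrite -card_lin_irr -sum1_card natr_sum.
rewrite (bigID (fun i => ('chi[G]_i)%R \is a linear_char)) /=; congr (_ + _)%R.
  by apply: eq_bigr => i lin_i; rewrite -normCK normC_lin_char // expr1n.
by apply: eq_bigr => i _; rewrite normCK.
Qed.

Lemma card_cent1_nonlinear0 (gT : finGroupType) (G : {group gT}) x : x \in G ->
    (forall i, ('chi[G]_i \isn't a linear_char -> 'chi_i x = 0)%R) ->
  #|'C_G[x]| = #|G : G^`(1)|.
Proof.
move=> Gx x0; apply/eqP; rewrite -eqC_nat (sum_nonlinear_norm Gx).
by rewrite big1 ?addr0 // => i /x0->; rewrite normr0 expr0n.
Qed.

Lemma nonlinear0_card_cent1 (gT : finGroupType) (G : {group gT}) x : x \in G ->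
    #|'C_G[x]| <= #|G : G^`(1)| ->
  forall i, ('chi[G]_i \isn't a linear_char -> 'chi_i x = 0)%R.
Proof.
move=> Gx leC i nlin_i; apply/eqP; rewrite -normr_eq0 -sqrf_eq0.
have: (\sum_(j | 'chi[G]_j \isn't a linear_char) `|'chi_j x| ^+ 2
         <= 0 :> algC)%R.
  move: leC; rewrite -(ler_nat algC) (sum_nonlinear_norm Gx).
  by rewrite gerDl.
rewrite (bigD1 i) //= => le0; rewrite eq_le exprn_ge0 // andbT.
apply: le_trans le0; rewrite lerDl sumr_ge0 // => j _; exact: exprn_ge0.
Qed.

(** The class of x lies in the coset of x, and |C_G(x)| = |G : G'| says that
the two have the same size. *)
Lemma lcoset_der1_class (gT : finGroupType) (G : {group gT}) x : x \in G ->
    (forall i, ('chi[G]_i \isn't a linear_char -> 'chi_i x = 0)%R) ->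
  x ^: G = x *: G^`(1).
Proof.
move=> Gx x0; apply/eqP; rewrite eqEcard card_lcoset -index_cent1.
rewrite (_ : #|G : _| = #|G^`(1)|) ?leqnn ?andbT; last first.
  apply/eqP; rewrite -(eqn_pmul2l (cardG_gt0 'C_G[x])) Lagrange ?subsetIl //.
  by rewrite (card_cent1_nonlinear0 Gx x0) mulnC Lagrange ?der_sub.
apply/subsetP => _ /imsetP[g Gg ->]; rewrite mem_lcoset.
by rewrite -commgEl mem_commg.
Qed.

(** * The derived subgroup under the multiplicative property *)

(** The multiplicative property makes chi(x ^ g * y) independent of g. Comparing
with the value of the average over g yields
chi(x)chi(y)chi(1) = chi(x)chi(y), and chi(1) <> 1. *)
Lemma irr_coprime_mult_nonlinear0 (gT : finGroupType) (G : {group gT}) x y :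
    irr_coprime_mult G -> x \in G -> y \in G -> x != 1 -> y != 1 ->
    prime_power #[x] -> prime_power #[y] -> coprime #[x] #[y] ->
  forall i, ('chi[G]_i \isn't a linear_char -> 'chi_i (x * y)%g = 0)%R.
Proof.
move=> multG Gx Gy ntx nty ppx ppy /eqP co_xy i nlin_i.
have chiJ g : g \in G -> ('chi_i (x ^ g * y)%g = 'chi_i x * 'chi_i y)%R.
  move=> Gg; rewrite multG ?groupJ ?orderJ ?conjg_eq1 //.
  by rewrite cfunJ.
rewrite multG //; have := sum_irr_conj_mul i Gx Gy.
rewrite (eq_bigr _ chiJ) sumr_const -[X in (X * _)%R]mulr_natl -mulrA.
move/(mulfI (neq0CG G))/eqP; rewrite -subr_eq0 -[X in (_ - X)%R]mulr1 -mulrBr.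
rewrite mulf_eq0 subr_eq0 => /orP[/eqP//|chi1].
by case/negP: nlin_i; rewrite qualifE /= irr_char.
Qed.

Lemma prime_power_prime p : prime p -> prime_power p.
Proof. by move=> pr_p; exists p, 1%N; rewrite expn1. Qed.

(** The class of x * y is the coset of x * y, which is that of y because x is
in G'. *)
Lemma irr_coprime_mult_lcoset (gT : finGroupType) (G : {group gT}) x y :
    irr_coprime_mult G -> x \in G^`(1) -> y \in G -> x != 1 -> y != 1 ->
    prime_power #[x] -> prime_power #[y] -> coprime #[x] #[y] ->
  y ^: G = y *: G^`(1).
Proof.
move=> multG G'x Gy ntx nty ppx ppy co_xy.
have Gx : x \in G := subsetP (der_sub 1 G) x G'x.
have xyG: (x * y) ^: G = (x * y) *: G^`(1).
  apply: lcoset_der1_class; rewrite ?groupM //.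
  exact: irr_coprime_mult_nonlinear0.
have defyG' : (x * y) *: G^`(1) = y *: G^`(1).
  apply/lcoset_eqP; rewrite mem_lcoset -conjgE.
  by rewrite memJ_norm // (subsetP (der_norm 1 G)).
rewrite -defyG' -xyG; apply: class_eqP.
by rewrite xyG defyG' lcoset_refl.
Qed.

(** If another prime q also divided |G'|, then elements x and y of G' of orders
p and q would make G' = yG' the class of y, although it contains 1. *)
Lemma irr_coprime_mult_der1_pgroup (gT : finGroupType) (G : {group gT}) p :
    irr_coprime_mult G -> prime p -> p %| #|G^`(1)| -> p.-group G^`(1).
Proof.
move=> multG pr_p /(Cauchy pr_p)[x G'x ox].
apply/pgroupP => q pr_q /(Cauchy pr_q)[y G'y oy]; rewrite inE /=.
apply: contraT => neq_qp.
have ntx : x != 1 by rewrite -order_gt1 ox prime_gt1.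
have nty : y != 1 by rewrite -order_gt1 oy prime_gt1.
have Gy := subsetP (der_sub 1 G) y G'y.
have := irr_coprime_mult_lcoset multG G'x Gy ntx nty.
rewrite ox oy => /(_ (prime_power_prime pr_p) (prime_power_prime pr_q)).
rewrite prime_coprime // dvdn_prime2 // eq_sym => /(_ neq_qp) yG.
have: 1 \in y ^: G by rewrite yG mem_lcoset mulg1 groupV.
by case/imsetP=> g _ /esym/eqP; rewrite conjg_eq1 (negPf nty).
Qed.

(** * Coprime and semiregular action *)

(** A acts faithfully and irreducibly on a minimal A-invariant subgroup of D, an
elementary abelian group; an abelian group with a faithful irreducible
representation is cyclic. *)
Lemma abelian_semiregular_cyclic (gT : finGroupType) (p : nat)
    (A D : {group gT}) :
    p.-group D -> D :!=: 1 -> A \subset 'N(D) -> abelian A -> semiregular D A ->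
  cyclic A.
Proof.
move=> pD ntD nDA abA regDA.
have [E minE sED] := minnormal_exists ntD nDA.
have [nEA ntE /is_abelemP[q pr_q abelE]] :=
  minnormal_solvable minE sED (pgroup_sol pD).
pose rA := abelem_repr abelE ntE nEA.
apply: (mx_faithful_irr_abelian_cyclic (rG := rA)) => //.
  rewrite /mx_faithful rker_abelem; apply/subsetP => a /setIP[Aa cEa].
  rewrite inE; apply: contraNT (ntE) => nta.
  rewrite -subG1 -(regDA a) ?inE ?nta // subsetI sED /=.
  by rewrite sub_cent1.
exact/abelem_mx_irrP.
Qed.

(** A centralizes P / D, and coprime action lifts fixed points from P / D to
P. *)
Lemma coprime_cent_mul_sub (gT : finGroupType) (A P D : {group gT}) :
    D <| P -> A \subset 'N(P) -> A \subset 'N(D) -> coprime #|P| #|A| ->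
    solvable P -> [~: P, A] \subset D ->
  'C_P(A) * D = P.
Proof.
move=> /andP[sDP nDP] nPA nDA coPA solP sRD.
have defQ : 'C_P(A) / D = P / D.
  rewrite (coprime_quotient_cent sDP) //; apply/setIidPl.
  by rewrite quotient_cents2 // nDP.
have nDC : 'C_P(A) \subset 'N(D) := subset_trans (subsetIl _ _) nDP.
by rewrite normC // -quotientK // defQ quotientGK //; apply/andP.
Qed.

Lemma card_cent1_compl (gT : finGroupType) (A P G : {group gT}) a :
    A * P = G -> A :&: P = 1 -> abelian A -> a \in A ->
  #|'C_G[a]| = (#|A| * #|'C_P[a]|)%N.
Proof.
move=> defG tiAP abA Aa.
have sAC : A \subset 'C[a] by rewrite sub_cent1 (subsetP abA).
rewrite -defG -group_modl // TI_cardMg //.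
by apply/trivgP; rewrite -tiAP setIS ?subsetIl.
Qed.

(** C_P(a) meets D trivially, so its order is at most |P : D|. *)
Lemma card_cent1_leq_index (gT : finGroupType) (A P D G : {group gT}) a :
    A * P = G -> A :&: P = 1 -> abelian A -> D \subset P -> a \in A ->
    'C_D[a] = 1 ->
  #|'C_G[a]| <= #|G : D|.
Proof.
move=> defG tiAP abA sDP Aa regDa.
rewrite (card_cent1_compl defG) //.
have sDG : D \subset G by rewrite -defG (subset_trans sDP) ?mulG_subr.
rewrite -divgS // leq_divRL ?cardG_gt0 // -mulnA -defG TI_cardMg //.
rewrite leq_mul2l; apply/orP; right.
have tiCD : 'C_P[a] :&: D = 1.
  by apply/trivgP; rewrite -regDa subsetI subsetIr subIset ?subsetIr.
by rewrite -(TI_cardMg tiCD) subset_leq_card // mul_subG ?subsetIl.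
Qed.

Lemma pgroup_not_coprime_order (gT : finGroupType) (p : nat) (P : {group gT})
    x y :
    p.-group P -> x \in P -> y \in P -> x != 1 -> y != 1 ->
  ~~ coprime #[x] #[y].
Proof.
move=> pP Px Py ntx nty.
have p_dvd z : z \in P -> z != 1 -> prime p /\ p %| #[z].
  rewrite -cycle_eq1 => Pz ntz.
  by have [pr_p p_z _] := pgroup_pdiv (mem_p_elt pP Pz) ntz.
have [pr_p p_x] := p_dvd x Px ntx; have [_ p_y] := p_dvd y Py nty.
apply/negP => /eqP co_xy; have: p %| gcdn #[x] #[y] by rewrite dvdn_gcd p_x.
by rewrite co_xy Euclid_dvd1.
Qed.

Lemma mem_normal_coprime_order (gT : finGroupType) (P : {group gT}) x y :
    x \in 'N(P) -> y \in 'N(P) -> coprime #[x] #[y] -> x * y \in P ->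
  (x \in P) && (y \in P).
Proof.
move=> Nx Ny co_xy Pxy.
have yVx : coset P y = (coset P x)^-1.
  by apply/esym/eqP; rewrite eq_invg_mul -morphM // -(coset_id Pxy).
have cox1 : coset P x = 1.
  apply/set1gP; rewrite -(@coprime_TIg _ <[coset P x]> <[coset P y]>).
    by rewrite inE cycle_id yVx /= cycleV cycle_id.
  apply: coprime_dvdl (morph_order _ Nx) _.
  exact: coprime_dvdr (morph_order _ Ny) co_xy.
by rewrite (coset_idr Nx cox1) (coset_idr Ny) // yVx cox1 invg1.
Qed.

(** * The structure implies the multiplicative property *)

(** The p'-part of g is nontrivial and conjugate into the p'-Hall subgroup A, so
its centralizer, which contains that of g, has order at most |G : D|. *)
Lemma nonlinear0_outside_Sylow (gT : finGroupType) (p : nat)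
    (G A P D : {group gT}) g :
    P <| G -> p.-Sylow(G) P -> A * P = G -> abelian A -> p^'.-group A ->
    D \subset P -> G^`(1) \subset D -> semiregular D A ->
    g \in G -> g \notin P ->
  forall i, ('chi[G]_i \isn't a linear_char -> 'chi_i g = 0)%R.
Proof.
move=> nsPG sylP defG abA p'A sDP sG'D regDA Gg notPg.
have pP := pHall_pgroup sylP.
have sAG : A \subset G by rewrite -defG mulG_subl.
have tiAP : A :&: P = 1 by rewrite setIC coprime_TIg // (pnat_coprime pP).
have solG : solvable G.
  rewrite (series_sol nsPG) (pgroup_sol pP) -defG quotientMidr.
  exact/quotient_sol/abelian_sol.
have hallA : p^'.-Hall(G) A.
  rewrite pHallE sAG /= -(mulnK #|A| (cardG_gt0 P)) -TI_cardMg // defG.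
  by rewrite (card_Hall sylP) -{1}(partnC p (cardG_gt0 G)) mulKn ?part_gt0.
have: <[g.`_p^']> \subset G by rewrite cycle_subG groupX.
case/(Hall_Jsub solG hallA) => [|u Gu]; first exact: p_elt_constt.
rewrite -cycleJ cycle_subG => Ag'.
apply: nonlinear0_card_cent1 => //.
apply: leq_trans (_ : #|'C_G[g.`_p^' ^ u]| <= _).
  rewrite -{2}(conjGid Gu) cent1J -conjIg cardJg subset_leq_card // setIS //.
  by rewrite -!cent_cycle centS // cycle_subG mem_cycle.
apply: leq_trans (card_cent1_leq_index defG tiAP abA sDP Ag' _) _.
  apply: regDA; rewrite !inE Ag' conjg_eq1 andbT.
  apply: contra notPg => /eqP g'1.
  rewrite (mem_normal_Hall sylP) // /p_elt -pnatNK.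
  exact/constt1P.
by rewrite dvdn_leq ?indexgS.
Qed.

Lemma structure_irr_coprime_mult (gT : finGroupType) (G : {group gT}) :
  cyclic_by_Sylow_structure G -> irr_coprime_mult G.
Proof.
case=> p [A] [P] /= [[_ _ cycA p'A] [nsPG sylP defG]].
rewrite -[[~: A, P]]/(gval [~: A, P]%G); move: [~: A, P]%G => D.
set C := 'C_P(A) => -[defP abC nsDG _] regDA.
have [sPG nPG] := andP nsPG; have [sDG nDG] := andP nsDG.
have pP := pHall_pgroup sylP; have abA := cyclic_abelian cycA.
have sDP : D \subset P by rewrite -defP mulG_subr.
have sG'D : G^`(1) \subset D.
  (* G / D is the image of A * C, a product of commuting abelian groups. *)
  apply: der1_min => //; rewrite -defG -defP mulgA quotientMidr.
  apply: quotient_abelian; rewrite /abelian.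
  have cAC : C \subset 'C(A) := subsetIr _ _.
  by rewrite centM subsetI !mul_subG // centsC.
have van g := @nonlinear0_outside_Sylow _ p G A P D g
  nsPG sylP defG abA p'A sDP sG'D regDA.
move=> x y Gx Gy ntx nty _ _ /eqP; rewrite -/(coprime _ _) => co_xy i.
have [lin_i|nlin_i] := boolP ('chi_i \is a linear_char)%R.
  by rewrite lin_charM.
have notPP : ~~ ((x \in P) && (y \in P)).
  apply/negP => /andP[Px Py].
  by have := pgroup_not_coprime_order pP Px Py ntx nty; rewrite co_xy.
have notPxy : x * y \notin P.
  apply: contra notPP; apply: mem_normal_coprime_order co_xy.
    exact: subsetP Gx.
  exact: subsetP Gy.
rewrite (van _ _ notPxy) ?groupM //.
by move: notPP; rewrite negb_and => /orP[] /van->; rewrite ?mul0r ?mulr0.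
Qed.

(** * The multiplicative property implies the structure *)

(** A coset filled by the class of y consists of the y * [~ y, g]; since A
centralizes y, the commutators with g in P already give all of G'. *)
Lemma der1_sub_commg (gT : finGroupType) (A P G : {group gT}) y :
    A * P = G -> abelian A -> y \in A -> y ^: G = y *: G^`(1) ->
  G^`(1) \subset [~: A, P].
Proof.
move=> defG abA Ay yG; apply/subsetP => z G'z.
have: y * z \in y ^: G by rewrite yG mem_lcoset mulKg.
case/imsetP => g; rewrite -defG => /mulsgP[b u Ab Pu ->].
rewrite conjgM (conjgE y b) -(centsP abA b Ab y Ay) mulKg => yz.
by rewrite -(mulKg y z) yz -commgEl mem_commg.
Qed.

(** The class of y has |G'| elements, so |C_P(y)| |G'| = |P|; coprime action of
y on P / G', where it is trivial, gives C_P(y) G' = P. Hence the product is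
direct. *)
Lemma der1_cent1_trivial (gT : finGroupType) (A P G : {group gT}) y :
    P <| G -> A * P = G -> abelian A -> coprime #|P| #|A| -> solvable P ->
    G^`(1) \subset P -> y \in A -> y ^: G = y *: G^`(1) ->
  'C_(G^`(1))[y] = 1.
Proof.
move=> /andP[sPG nPG] defG abA coPA solP sG'P Ay yG.
have sAG : A \subset G by rewrite -defG mulG_subl.
have tiAP : A :&: P = 1 by rewrite setIC coprime_TIg.
have sYA : <[y]> \subset A by rewrite cycle_subG.
have sYG := subset_trans sYA sAG.
have defP : 'C_P[y] * G^`(1) = P.
  rewrite -cent_cycle; apply: coprime_cent_mul_sub => //.
  - by rewrite /normal sG'P (subset_trans sPG) ?der_norm.
  - exact: subset_trans nPG.
  - exact: subset_trans (der_norm 1 G).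
  - exact: coprimegS coPA.
  exact: commgSS.
have cardC : (#|'C_P[y]| * #|G^`(1)| = #|P|)%N.
  apply/eqP; rewrite -(eqn_pmul2l (cardG_gt0 A)) mulnA.
  rewrite -(card_cent1_compl defG) // -TI_cardMg // defG.
  rewrite -[X in (_ * X)%N](card_lcoset _ y) -yG -index_cent1.
  by rewrite Lagrange ?subsetIl.
have := mul_cardG 'C_P[y] G^`(1); rewrite defP cardC -{1}[#|P|]muln1.
move/eqP; rewrite eqn_pmul2l // => /eqP/esym/card1_trivg tiC; apply/trivgP.
by rewrite -tiC !subsetI subsetIr subsetIl (subset_trans (subsetIl _ _) sG'P).
Qed.

Lemma irr_coprime_mult_structure (gT : finGroupType) (G : {group gT}) :
    irr_coprime_mult G -> ~~ abelian G ->
  prime_power #|G| \/ cyclic_by_Sylow_structure G.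
Proof.
move=> multG nabG.
have ntG' : G^`(1) != 1 by apply: contra nabG => /eqP/derG1P.
have [p pr_p pG'] : exists2 p, prime p & p %| #|G^`(1)|.
  by exists (pdiv #|G^`(1)|); rewrite ?pdiv_prime ?pdiv_dvd // cardG_gt1.
have pgrG' := irr_coprime_mult_der1_pgroup multG pr_p pG'.
have [x G'x ox] := Cauchy pr_p pG'.
have ntx : x != 1 by rewrite -order_gt1 ox prime_gt1.
have [P sylP] := Sylow_exists p G.
have sPG := pHall_sub sylP; have pP := pHall_pgroup sylP.
have sG'P : G^`(1) \subset P.
  exact: subset_trans (pcore_max pgrG' (der_normal 1 G)) (pcore_sub_Hall sylP).
have nsPG := sub_der1_normal sG'P sPG.
have /splitsP[A /complP[tiPA defPA]] :=
  SchurZassenhaus_split (pHall_Hall sylP) nsPG.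
have sAG : A \subset G by rewrite -defPA mulG_subr.
have nPA : A \subset 'N(P) := subset_trans sAG (normal_norm nsPG).
have defG : A * P = G by rewrite normC.
have tiAP : A :&: P = 1 by rewrite setIC.
have p'A : p^'.-group A.
  have [_ _] := and3P sylP.
  by rewrite -divgS // -defPA TI_cardMg // mulKn.
have coPA : coprime #|P| #|A| := pnat_coprime pP p'A.
have abA : abelian A.
  apply/derG1P/trivgP; rewrite -tiAP subsetI der_sub.
  exact: subset_trans (dergS 1 sAG) sG'P.
have [A1 | ntA] := eqVneq (A : {set gT}) 1.
  left; rewrite -defG A1 mul1g.
  by have [k ->] := p_natP pP; exists p, k.
have classA y : y \in A -> prime_power #[y] -> y != 1 -> y ^: G = y *: G^`(1).
  move=> Ay ppy nty; apply: (irr_coprime_mult_lcoset multG G'x) => //.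
  - exact: subsetP Ay.
  - by rewrite ox; apply: prime_power_prime.
  by rewrite ox prime_coprime // -p'natE //; apply: mem_p_elt p'A Ay.
(* Elements of prime order suffice: the centralizer of a lies in that of its
   powers. *)
have primeA a : a \in A -> a != 1 ->
    exists y, [/\ y \in A, y \in <[a]>, y != 1 & prime_power #[y]].
  move=> Aa nta; have pr_q : prime (pdiv #[a]) by rewrite pdiv_prime ?order_gt1.
  have [y ya oy] := Cauchy pr_q (pdiv_dvd #|<[a]>|).
  exists y; split=> //.
  - by apply: subsetP ya; rewrite cycle_subG.
  - by rewrite -order_gt1 oy prime_gt1.
  by rewrite oy; apply: prime_power_prime.
have solP := pgroup_sol pP.
have defD : G^`(1) = [~: A, P].
  apply/eqP; rewrite eqEsubset (commgSS sAG sPG) andbT.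
  have [a Aa nta] := trivgPn _ ntA.
  have [y [Ay _ nty ppy]] := primeA a Aa nta.
  exact: der1_sub_commg (classA y Ay ppy nty).
have nDA : A \subset 'N(G^`(1)) := subset_trans sAG (der_norm 1 G).
have regDA : semiregular G^`(1) A.
  move=> a /setD1P[nta Aa]; apply/trivgP.
  have [y [Ay ay nty ppy]] := primeA a Aa nta.
  rewrite -(der1_cent1_trivial nsPG defG abA coPA solP sG'P Ay) ?classA //.
  by apply: setIS; rewrite /= -!cent_cycle centS ?cycle_subG.
right; exists p, A, P; rewrite /= -defD; split=> //.
- by split=> //; apply: (abelian_semiregular_cyclic pgrG' ntG' nDA).
have tiCD : 'C_P(A) :&: G^`(1) = 1.
  have [a Aa nta] := trivgPn _ ntA.
  apply/trivgP; rewrite -(regDA a) ?inE ?nta // subsetI subsetIr /= !subIset //.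
  by rewrite -cent_set1 centS ?sub1set // orbT.
split=> //.
- apply: coprime_cent_mul_sub => //; last by rewrite commGC -defD.
  by rewrite /normal sG'P (subset_trans sPG) ?der_norm.
- apply/derG1P/trivgP; rewrite -tiCD subsetI der_sub dergS //.
  by rewrite (subset_trans _ sPG) ?subsetIl.
exact: der_normal.
Qed.

Theorem theoremC (gT : finGroupType) (G : {group gT}) :
  irr_coprime_mult G <->
  [\/ prime_power #|G|, abelian G | cyclic_by_Sylow_structure G].
Proof.
split=> [multG | [ppG | abG | strG]].
- have [abG|nabG] := boolP (abelian G); first by apply: Or32.
  by case: (irr_coprime_mult_structure multG nabG) => [ppG | strG];
    [apply: Or31 | apply: Or33].
- case: ppG => p [k [pr_p oG]] x y Gx Gy ntx nty _ _ co_xy.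
  have pG : p.-group G by rewrite /pgroup oG pnatX pnat_id.
  by have := pgroup_not_coprime_order pG Gx Gy ntx nty; rewrite /coprime co_xy.
- move=> x y Gx Gy _ _ _ _ _ i; rewrite lin_charM //.
  exact/char_abelianP.
exact: structure_irr_coprime_mult.
Qed.
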